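(* Let $0\le j\le k$ be integers. Then $$\mathbb{G}(k,j)=\begin{cases}G(k,j)&(k\text{ odd}),\\ H(k,j)&(k\text{ even}).\end{cases}$$
   Context: $\mathbb{G}(k,j)$ is the number of permutations $\sigma\in\mathfrak{S}_{k-1}$ with $\sigma(1)=j$ that are Dumont permutations (of the first kind), i.e. for $1\le i\le k-2$: $\sigma(i)<\sigma(i+1)$ if and only if $\sigma(i)$ is odd (no condition is imposed on the last value $\sigma(k-1)$). Conventions: $\mathbb{G}(k,0)=0$ for all $k\ge0$, $\mathbb{G}(k,k)=0$ for all $k \ge 1$ (so $\mathbb{G}(0,0)=\mathbb{G}(1,0)=\mathbb{G}(1,1)=0$), and $\mathbb{G}(2,1)=1$. Example: $\mathbb{G}(5,2)=|\{(2,1,3,4),(2,1,4,3)\}|=2$. $G_n$ are the Genocchi numbers with $G_1=1$: $\sum_{n\ge0}G_n\frac{X^n}{n!}=\frac{2X}{e^X+1}$, i.e. $G_n=2(1-2^n)B_n$ with $B_n$ the Bernoulli numbers, $B_1=-1/2$. For integers $0\le j\le k$: $$G(k,j)=(-1)^{\lfloor (k-1)/2\rfloor}\sum_{n=1}^{j}\binom{j}{n}G_{k-n},\qquad H(k,j)=(-1)^{\lfloor (k-1)/2\rfloor}\sum_{n=1}^{j}h(j,n)\,G_{k-n},$$ where $h(j,n)=\sum_{u=n}^{j}(-1)^{j-u}\binom{u-1}{n-1}$. *)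

(* Defs.v *)
From HB Require Import structures.
From mathcomp Require Import all_boot all_order all_fingroup all_algebra.

Set Implicit Arguments.
Unset Strict Implicit.
Unset Printing Implicit Defensive.

Import Order.TTheory GRing.Theory Num.Theory.
Local Open Scope ring_scope.

(* A permutation s of {0, ..., n-1} encodes the permutation sigma of
   {1, ..., n} with sigma(i+1) = (s i).+1. Comparisons of values are unaffected
   by the shift, but the parity test is on the shifted value. *)
Definition dumont (n : nat) (s : {perm 'I_n}) : bool :=
  [forall i : 'I_n, forall i' : 'I_n,
     (i' == i.+1 :> nat) ==> ((s i < s i')%N == odd (s i).+1)].

(* sigma(1) = j; always false when n = 0. *)
Definition starts_with (n : nat) (j : nat) (s : {perm 'I_n}) : bool :=
  [exists i : 'I_n, (i == 0%N :> nat) && ((s i).+1 == j)].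

(* For k = 0, the truncated k.-1 gives the group on the empty set, and the count
   is 0; the boundary conventions are lemmas below. *)
Definition dumont_count (k j : nat) : nat :=
  #|[set s : {perm 'I_k.-1} | dumont s && starts_with j s]|.

Lemma dumont_count0r (k : nat) : dumont_count k 0 = 0%N.
Proof.
apply/eqP; rewrite cards_eq0; apply/eqP/setP => s; rewrite !inE.
by apply/negbTE; rewrite negb_and; apply/orP; right; apply/existsP => -[i /andP[]].
Qed.

Lemma dumont_countkk (k : nat) : dumont_count k k = 0%N.
Proof.
case: k => [|k]; first exact: dumont_count0r.
apply/eqP; rewrite cards_eq0; apply/eqP/setP => s; rewrite !inE.
apply/negbTE; rewrite negb_and; apply/orP; right.
by apply/existsP => -[i /andP[_ /eqP[e]]]; have := ltn_ord (s i); rewrite e ltnn.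
Qed.

Lemma dumont_count21 : dumont_count 2 1 = 1%N.
Proof.
rewrite /dumont_count /= (_ : [set s | _] = setT).
  by rewrite cardsT card_Sn.
apply/setP => s; rewrite !inE; apply/andP; split.
  by apply/forallP => i; apply/forallP => -[[|m] lt_m].
by apply/existsP; exists ord0; case: (s ord0) => -[].
Qed.

(* Formal power series over rat, as coefficient sequences. *)
Definition fps_mul (a b : nat -> rat) (n : nat) : rat :=
  \sum_(i < n.+1) a i * b (n - i)%N.

(* Coefficients n, n-1, ..., 0 (in this order) of 1 / a, for a 0 != 0. *)
Fixpoint fps_inv_seq (a : nat -> rat) (n : nat) : seq rat :=
  if n is m.+1 then
    let s := fps_inv_seq a m in
    - (a 0%N)^-1 * (\sum_(i < m.+1) a i.+1 * s`_i) :: s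
  else [:: (a 0%N)^-1].

Definition fps_inv (a : nat -> rat) (n : nat) : rat := (fps_inv_seq a n)`_0.

Lemma nth_fps_inv_seq (a : nat -> rat) (n i : nat) :
  (i <= n)%N -> (fps_inv_seq a n)`_i = fps_inv a (n - i).
Proof.
elim: n i => [|n IHn] [|i] //= le_in.
by rewrite subSS -IHn.
Qed.

Lemma fps_mulV (a : nat -> rat) (n : nat) :
  a 0%N != 0 -> fps_mul a (fps_inv a) n = (n == 0%N)%:R.
Proof.
move=> a0; case: n => [|n]; rewrite /fps_mul big_ord_recl /= subn0.
  by rewrite big_ord0 addr0 /fps_inv /= divff.
rewrite {1}/fps_inv /= mulrA mulrN divff // mulN1r.
apply/eqP; rewrite addrC subr_eq0; apply/eqP; apply: eq_bigr => i _.
by rewrite nth_fps_inv_seq ?subSS // -ltnS.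
Qed.

Definition fps_2X (n : nat) : rat := if n == 1%N then 2 else 0.
Definition fps_expX_add1 (n : nat) : rat :=
  (n`!%:R)^-1 + (if n == 0%N then 1 else 0).

(* sum_n G_n X^n / n! = 2X / (e^X + 1) *)
Definition genocchi (n : nat) : rat :=
  n`!%:R * fps_mul fps_2X (fps_inv fps_expX_add1) n.

Lemma genocchi_egf (n : nat) :
  fps_mul fps_expX_add1 (fun m => genocchi m / m`!%:R) n = fps_2X n.
Proof.
have egf0 : genocchi 0 / 0`!%:R = 0.
  suff -> : genocchi 0 = 0 by exact: mul0r.
  rewrite /genocchi (_ : fps_mul _ _ 0 = 0) ?mulr0 //.
  by rewrite /fps_mul big_ord1; exact: mul0r.
have egfS m : genocchi m.+1 / m.+1`!%:R = 2 * fps_inv fps_expX_add1 m.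
  rewrite /genocchi mulrAC divff ?mul1r; last by rewrite pnatr_eq0 -lt0n fact_gt0.
  rewrite /fps_mul 2!big_ord_recl /= /fps_2X /= mul0r add0r subSS subn0.
  by rewrite big1 ?addr0 // => i _; rewrite mul0r.
case: n => [|n]; first by rewrite /fps_mul big_ord1 subnn egf0 mulr0.
rewrite /fps_mul big_ord_recr /= subnn egf0 mulr0 addr0.
have e0 : fps_expX_add1 0 != 0 by [].
transitivity (2 * fps_mul fps_expX_add1 (fps_inv fps_expX_add1) n).
  rewrite /fps_mul mulr_sumr; apply: eq_bigr => i _.
  by rewrite subSn -1?ltnS // egfS mulrCA.
by rewrite fps_mulV // /fps_2X eqSS; case: eqP => _; rewrite ?mulr1 ?mulr0.
Qed.

Definition dumont_sign (k : nat) : rat := (-1) ^ ((k%:Z - 1) %/ 2)%Z.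

Definition Gsum (k j : nat) : rat :=
  dumont_sign k * \sum_(1 <= n < j.+1) 'C(j, n)%:R * genocchi (k - n).

Definition hcoef (j n : nat) : rat :=
  \sum_(n <= u < j.+1) (-1) ^+ (j - u) * 'C(u.-1, n.-1)%:R.

Definition Hsum (k j : nat) : rat :=
  dumont_sign k * \sum_(1 <= n < j.+1) hcoef j n * genocchi (k - n).

(* Main.v *)
(* The labels "followed by an ascent" (true) and "followed by a descent" (false)
   of the values form a word; Dumont permutations belong to alternating words.
   Deleting the first entry of a permutation deletes a letter of the word, which
   gives a recursion over all words. It is solved by operators on polynomials: a
   letter acts as N or N * Delta, the letter of the first entry as the backward
   shift T or as 1 - T, and the permutations whose last value is labelled true
   are counted by the value at 1 of the image of 1; the others are obtained by
   complementing the values. The recursion then follows from the commutation of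
   T with the letters. On alternating words, a local operator identity computes
   the second difference in the first value, which gives a discrete Dirichlet
   problem (solved by induction on k) with a symmetric solution. The sums of
   Genocchi numbers solve the same problem, their boundary values being 0 since
   Genocchi numbers of odd index at least 3 vanish. *)

Require Import Defs.
From HB Require Import structures.
From mathcomp Require Import all_boot all_order all_fingroup all_algebra.
From mathcomp Require Import ring lra zify.

Set Implicit Arguments.
Unset Strict Implicit.
Unset Printing Implicit Defensive.

Import Order.TTheory GRing.Theory Num.Theory.
Local Open Scope ring_scope.

(** * Words as operators on polynomials *)

Section Operators.
Variable R : comNzRingType.
Implicit Types (p q : {poly R}) (s t u v : seq bool).

Definition shift_down (p : {poly R}) : {poly R} := p \Po ('X - 1).
Definition shift_up (p : {poly R}) : {poly R} := p \Po ('X + 1).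

Definition letter (b : bool) (p : {poly R}) : {poly R} :=
  if b then 'X * p else 'X * (shift_up p - p).

Arguments letter : simpl never.

Definition mark (b : bool) (p : {poly R}) : {poly R} :=
  if b then shift_down p else p - shift_down p.

Definition run (s : seq bool) (p : {poly R}) : {poly R} :=
  foldl (fun q b => letter b q) p s.

Lemma shift_downB p q : shift_down (p - q) = shift_down p - shift_down q.
Proof. exact: raddfB. Qed.

Lemma shift_upB p q : shift_up (p - q) = shift_up p - shift_up q.
Proof. exact: raddfB. Qed.

Lemma shift_downM p q : shift_down (p * q) = shift_down p * shift_down q.
Proof. exact: comp_polyM. Qed.

Lemma shift_upM p q : shift_up (p * q) = shift_up p * shift_up q.
Proof. exact: comp_polyM. Qed.

Lemma shift_downX : shift_down 'X = 'X - 1.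
Proof. exact: comp_polyX. Qed.

Lemma shift_upX : shift_up 'X = 'X + 1.
Proof. exact: comp_polyX. Qed.

Lemma shift_down1 : shift_down 1 = 1.
Proof. exact: comp_polyC. Qed.

Lemma shift_upK p : shift_down (shift_up p) = p.
Proof.
rewrite /shift_down /shift_up -comp_polyA comp_polyD comp_polyX.
by rewrite -polyC1 comp_polyC subrK comp_polyXr.
Qed.

Lemma shift_downK p : shift_up (shift_down p) = p.
Proof.
rewrite /shift_down /shift_up -comp_polyA comp_polyB comp_polyX.
by rewrite -polyC1 comp_polyC addrK comp_polyXr.
Qed.

Lemma horner_shift_down p x : (shift_down p).[x] = p.[x - 1].
Proof. by rewrite /shift_down horner_comp !hornerE. Qed.

Definition shiftE := (shift_downB, shift_upB, shift_downM, shift_upM,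
  shift_downX, shift_upX, shift_upK, shift_downK).

Lemma letterB b p q : letter b (p - q) = letter b p - letter b q.
Proof. by case: b; rewrite /letter ?shiftE; ring. Qed.

(** The commutator of a letter with [shift_down] is the corresponding [mark]; this dictates the form
    of [mark]. *)
Lemma letter_shift_down b p :
  letter b (shift_down p) = shift_down (letter b p) + mark b p.
Proof. by case: b; rewrite /letter /mark !shiftE; ring. Qed.

Lemma letter_mark_diff2 b p :
  mark b (letter (~~ b) (letter b p)) - letter b (mark (~~ b) (letter b p))
    - (letter b (mark (~~ b) (letter b p)) - letter b (letter (~~ b) (mark b p)))
  = - mark b p - (-1) ^+ (~~ b) * letter b p.
Proof. by case: b; rewrite /letter /mark /= !shiftE; ring. Qed.

Lemma run_cat s t p : run (s ++ t) p = run t (run s p).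
Proof. exact: foldl_cat. Qed.

Lemma runB s p q : run s (p - q) = run s p - run s q.
Proof. by elim: s p q => //= b s IHs p q; rewrite letterB IHs. Qed.

Lemma run0 s : run s 0 = 0.
Proof. by have := runB s 0 0; rewrite !subrr. Qed.

Lemma runN s p : run s (- p) = - run s p.
Proof. by rewrite -sub0r runB run0 sub0r. Qed.

Lemma runD s p q : run s (p + q) = run s p + run s q.
Proof. by rewrite -[q]opprK runB runN !opprK. Qed.

Lemma run_sum s (I : finType) (p : I -> {poly R}) :
  run s (\sum_i p i) = \sum_i run s (p i).
Proof. exact: (big_morph (run s) (runD s) (run0 s)). Qed.

Lemma horner_run_0 s p : (0 < size s)%N -> (run s p).[0] = 0.
Proof.
case/lastP: s => // s b _; rewrite -cats1 run_cat /= /letter.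
by case: b; rewrite hornerM hornerX mul0r.
Qed.

Definition run_marked (s : seq bool) (j : nat) (p : {poly R}) : {poly R} :=
  run (drop j.+1 s) (mark (nth false s j) (run (take j s) p)).

Lemma run_marked_cat u b v p :
  run_marked (u ++ b :: v) (size u) p = run v (mark b (run u p)).
Proof.
rewrite /run_marked nth_cat ltnn subnn take_size_cat //=.
by rewrite -cat_rcons drop_size_cat // size_rcons.
Qed.

Lemma run_marked_cat_l u v i p :
  (i < size u)%N -> run_marked (u ++ v) i p = run v (run_marked u i p).
Proof.
move=> lti; rewrite /run_marked nth_cat lti takel_cat; last exact: ltnW.
rewrite drop_cat; have [_|le] := ltnP i.+1 (size u); first by rewrite run_cat.
by rewrite (anti_leq (introT andP (conj lti le))) subnn drop0 drop_size.
Qed.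

Lemma run_marked_cat_r u v i p :
  run_marked (u ++ v) (size u + i) p = run_marked v i (run u p).
Proof.
rewrite /run_marked nth_cat ltnNge leq_addr /= addKn take_cat ltnNge leq_addr /=.
by rewrite addKn run_cat -addnS drop_cat ltnNge leq_addr /= addKn.
Qed.

(** A Leibniz rule: moving [shift_down] past the letters one by one leaves one marked letter per
    position. *)
Lemma run_shift_down s p :
  run s (shift_down p)
  = shift_down (run s p) + \sum_(i < size s) run_marked s i p.
Proof.
elim: s p => [|b s IHs] p; first by rewrite big_ord0 addr0.
rewrite big_ord_recl /= letter_shift_down runD IHs -addrA; congr (_ + _).
by rewrite addrC /run_marked /= drop0.
Qed.

(* The permutations with word [s] and first value [j] whose last value has label
   [true]. *)
Definition count_up (s : seq bool) (j : nat) : R := (run_marked s j 1).[1].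

(** The mark is [shift_down], which is moved through [v]. Once outermost, it turns evaluation at 1
    into evaluation at 0, where a multiple of ['X] vanishes. *)
Lemma count_up_true u v : (0 < size (u ++ v))%N ->
  count_up (u ++ true :: v) (size u)
  = \sum_(i < size v) count_up (u ++ v) (size u + i).
Proof.
move=> uv_gt0; rewrite /count_up run_marked_cat /= run_shift_down hornerD.
rewrite horner_shift_down subrr -run_cat horner_run_0 // add0r horner_sum.
by apply: eq_bigr => i _; rewrite run_marked_cat_r.
Qed.

(** Since [shift_down] fixes 1, the Leibniz rule for [u] expresses [run u 1 - shift_down (run u 1)]
    by marked runs. *)
Lemma count_up_false u v :
  count_up (u ++ false :: v) (size u) = \sum_(i < size u) count_up (u ++ v) i.
Proof.
have := run_shift_down u 1; rewrite shift_down1 => run_u.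
rewrite /count_up run_marked_cat /= [X in X - _]run_u addrAC subrr add0r.
rewrite run_sum horner_sum.
by apply: eq_bigr => i _; rewrite run_marked_cat_l.
Qed.

Definition revneg (s : seq bool) : seq bool := rev (map negb s).

Lemma size_revneg s : size (revneg s) = size s.
Proof. by rewrite size_rev size_map. Qed.

Lemma revneg_cat u v : revneg (u ++ v) = revneg v ++ revneg u.
Proof. by rewrite /revneg map_cat rev_cat. Qed.

Lemma revneg_cons u b v : revneg (u ++ b :: v) = revneg v ++ ~~ b :: revneg u.
Proof. by rewrite /revneg map_cat rev_cat /= rev_cons cat_rcons. Qed.

(* [revneg] is the effect on words of complementing the values of a permutation;
   it exchanges the two possible labels of the last value. *)
Definition word_count (s : seq bool) (j : nat) : R :=
  count_up s j + count_up (revneg s) (size s - j.+1).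

(** Complementation exchanges the letters and reverses positions, so the second summand obeys
    [count_up_false]. *)
Lemma word_count_true u v : (0 < size (u ++ v))%N ->
  word_count (u ++ true :: v) (size u)
  = \sum_(i < size v) word_count (u ++ v) (size u + i).
Proof.
move=> uv_gt0; rewrite /word_count revneg_cons size_cat /= addnS subSS addKn.
have := count_up_false (revneg v) (revneg u); rewrite size_revneg => ->.
rewrite count_up_true // big_split; congr (_ + _).
rewrite (reindex_inj rev_ord_inj) /=; apply: eq_bigr => i _.
by rewrite revneg_cat size_cat -addnS subnDl.
Qed.

Lemma word_count_false u v : (0 < size (u ++ v))%N ->
  word_count (u ++ false :: v) (size u) = \sum_(i < size u) word_count (u ++ v) i.
Proof.
move=> uv_gt0; rewrite /word_count revneg_cons size_cat /= addnS subSS addKn.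
have := @count_up_true (revneg v) (revneg u).
rewrite -revneg_cat !size_revneg => ->; last by [].
rewrite count_up_false big_split; congr (_ + _).
rewrite (reindex_inj rev_ord_inj) /=; apply: eq_bigr => i _.
rewrite size_cat; congr count_up.
by have := ltn_ord i; lia.
Qed.

Lemma word_count1 b : word_count [:: b] 0 = 1.
Proof.
by case: b; rewrite /word_count /count_up /run_marked /= shift_down1 ?subrr hornerC ?hornerE.
Qed.

(* The last term is the number of permutations with word [u ++ b :: v], last
   label [true] and arbitrary first value. *)
Lemma count_up_diff2 u b v :
  let s := u ++ b :: ~~ b :: b :: v in
  count_up s (size u).+2 - count_up s (size u).+1
    - (count_up s (size u).+1 - count_up s (size u))
  = - count_up (u ++ b :: v) (size u)
    - (-1) ^+ (~~ b) * (run (u ++ b :: v) 1).[1] :> R.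
Proof.
move=> s; rewrite /count_up.
have -> : run_marked s (size u).+2 1
    = run v (mark b (letter (~~ b) (letter b (run u 1)))) :> {poly R}.
  have := run_marked_cat (u ++ [:: b; ~~ b]) b v (1 : {poly R}).
  by rewrite -catA size_cat addn2 run_cat.
have -> : run_marked s (size u).+1 1
    = run v (letter b (mark (~~ b) (letter b (run u 1)))) :> {poly R}.
  have := run_marked_cat (u ++ [:: b]) (~~ b) (b :: v) (1 : {poly R}).
  by rewrite -catA size_cat addn1 run_cat.
rewrite !run_marked_cat run_cat /=.
have := congr1 (fun q => (run v q).[1]) (letter_mark_diff2 b (run u 1)).
rewrite /= !(runB, runN, hornerD, hornerN) => ->.
by case: {s} b => /=; rewrite ?expr0 ?expr1 ?mul1r ?mulN1r ?runN ?hornerN.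
Qed.

(** A greatest value labelled [true] must come last; deleting it leaves a last value labelled
    [true]. *)
Lemma count_up_rcons s j : (j < size s)%N ->
  count_up (rcons s true) j = count_up s j.
Proof.
by move=> ltj; rewrite /count_up -cats1 run_marked_cat_l //= /letter hornerM hornerX mul1r.
Qed.

Lemma count_up_rcons_size s : (0 < size s)%N ->
  count_up (rcons s true) (size s) = 0.
Proof.
move=> s_gt0; rewrite /count_up -cats1 run_marked_cat /= horner_shift_down subrr.
exact: horner_run_0.
Qed.

Lemma letter_false1 : letter false 1 = 0 :> {poly R}.
Proof. by rewrite /letter /shift_up -polyC1 comp_polyC subrr mulr0. Qed.

(** A smallest value labelled [false] must come last, but the last label has to be [true]. *)
Lemma count_up_false_cons s j : count_up (false :: s) j = 0.
Proof.
rewrite /count_up; case: j => [|j]; rewrite /run_marked /=.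
  by rewrite drop0 shift_down1 subrr run0 horner0.
have letter0 b : mark b 0 = 0 :> {poly R}.
  by rewrite -(subrr (1 : {poly R})) /mark shift_downB shift_down1 !subrr; case: b.
by rewrite letter_false1 run0 letter0 run0 horner0.
Qed.

(** The second smallest value, labelled [false] and not last, is directly followed by the smallest,
    which is therefore not first. *)
Lemma count_up_cons2_0 s : count_up (true :: false :: s) 0 = 0.
Proof. by rewrite /count_up /run_marked /= shift_down1 letter_false1 run0 horner0. Qed.

Lemma count_up_cons2_1 s : count_up (true :: false :: s) 1 = (run s 1).[1].
Proof.
rewrite /count_up /run_marked /= drop0 /letter mulr1 shift_downX.
by rewrite (_ : 'X - ('X - 1) = 1) //; ring.
Qed.

End Operators.

(** * Deleting the first entry *)

Definition follows (s : seq bool) (n : nat) (p : {perm 'I_n}) : bool :=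
  [forall i : 'I_n, forall i' : 'I_n,
     (i' == i.+1 :> nat) ==> ((p i < p i')%N == nth false s (p i))].

Definition remove (s : seq bool) (j : nat) : seq bool := take j s ++ drop j.+1 s.

Lemma nth_remove s j i : (j < size s)%N ->
  nth false (remove s j) i = nth false s (bump j i).
Proof.
move=> ltj; rewrite /remove nth_cat size_takel; last exact: ltnW.
rewrite /bump; case: leqP => [le_ji | lt_ij].
  by rewrite nth_drop add1n addSn subnKC.
by rewrite nth_take.
Qed.

Lemma follows_lift s n (j : 'I_n.+2) (q : {perm 'I_n.+1}) : size s = n.+2 ->
  follows s (lift_perm ord0 j q)
  = ((j <= q ord0)%N == nth false s j) && follows (remove s j) q.
Proof.
move=> sz_s; have ltj : (j < size s)%N by rewrite sz_s.
have lt_bump x : (j < bump j x)%N = (j <= x)%N.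
  by rewrite /bump; case: (leqP j x); lia.
apply/forallP/andP => [Hs | [Hj Hq]].
  split.
    have /forallP/(_ (lift ord0 ord0)) := Hs ord0.
    by rewrite lift_perm_id lift_perm_lift /= lt_bump.
  apply/forallP => i; apply/forallP => i'; apply/implyP => /eqP i'E.
  have /forallP/(_ (lift ord0 i')) := Hs (lift ord0 i).
  rewrite !lift_perm_lift /= i'E eqxx /= nth_remove //.
  by rewrite !ltnNge leq_bump2.
move=> i; apply/forallP => i'; apply/implyP.
case: (unliftP ord0 i') => [k' ->|-> //]; case: (unliftP ord0 i) => [k ->|->].
  rewrite /= !/bump /= !add1n eqSS => k'E; rewrite !lift_perm_lift /=.
  have /forallP/(_ k) /forallP/(_ k') := Hq.
  by rewrite k'E /= nth_remove // !ltnNge leq_bump2.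
rewrite /= /bump /= add1n eqSS => /eqP k'0.
rewrite lift_perm_id lift_perm_lift (_ : k' = ord0) /=; last exact: val_inj.
by rewrite lt_bump.
Qed.

Lemma lift_perm_inj n (i j : 'I_n.+1) : injective (@lift_perm n i j).
Proof.
move=> q1 q2 e; apply/permP => k; apply: (@lift_inj _ j).
by rewrite -!(@lift_perm_lift _ i) e.
Qed.

Lemma lift_permP n (i j : 'I_n.+1) (p : {perm 'I_n.+1}) :
  p i = j -> exists q, p = lift_perm i j q.
Proof.
move=> pij.
have lift_ex k : {l | p (lift i k) = lift j l}.
  have : j != p (lift i k) by rewrite -pij (inj_eq perm_inj) neq_lift.
  by case/unlift_some => l pl _; exists l.
have f_inj : injective (fun k => sval (lift_ex k)).
  move=> k1 k2 /= e; apply: (@lift_inj _ i); apply: (@perm_inj _ p).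
  by rewrite (svalP (lift_ex k1)) (svalP (lift_ex k2)) e.
exists (perm f_inj); apply/permP => k.
case: (unliftP i k) => [l|] ->; last by rewrite lift_perm_id.
by rewrite lift_perm_lift permE; exact: svalP (lift_ex l).
Qed.

Definition nfollow (s : seq bool) (n : nat) (j : 'I_n.+1) : nat :=
  #|[set p : {perm 'I_n.+1} | follows s p && (p ord0 == j)]|.

Lemma nfollow_rec s n (j : 'I_n.+2) : size s = n.+2 ->
  nfollow s j = \sum_(i : 'I_n.+1 | (j <= i)%N == nth false s j) nfollow (remove s j) i.
Proof.
move=> sz_s; rewrite /nfollow.
transitivity #|[set q : {perm 'I_n.+1} | ((j <= q ord0)%N == nth false s j)
                                          && follows (remove s j) q]|.
  rewrite -(card_imset _ (@lift_perm_inj _ ord0 j)); apply: eq_card => p.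
  rewrite inE; apply/andP/imsetP => [[sp /eqP/lift_permP[q pE]] | [q Hq ->]].
    by exists q; rewrite // inE -follows_lift // -pE.
  by rewrite lift_perm_id eqxx follows_lift //; move: Hq; rewrite inE.
rewrite -sum1_card (partition_big (fun q : {perm 'I_n.+1} => q ord0)
  (fun i : 'I_n.+1 => (j <= i)%N == nth false s j)) /=; last first.
  by move=> q; rewrite inE => /andP[].
apply: eq_bigr => i Hi; rewrite -sum1_card; apply: eq_bigl => q; rewrite !inE.
by case: (q ord0 =P i) => [->|_]; rewrite ?andbF // Hi.
Qed.

(** Both sides obey the same recursion under deletion of the first entry and agree on one-letter
    words. *)
Lemma nfollow_word_count s n (j : 'I_n.+1) : size s = n.+1 ->
  (nfollow s j)%:R = word_count rat s j.
Proof.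
elim: n s j => [|n IHn] s j sz_s.
  case: s sz_s => [|b []] // _; rewrite [j]ord1 word_count1 /nfollow.
  rewrite (_ : [set p | _] = setT) ?cardsT ?card_Sn //.
  apply/setP => p; rewrite !inE; apply/andP; split; last first.
    by rewrite [p ord0]ord1.
  by apply/forallP => i; apply/forallP => i'; rewrite [i]ord1 [i']ord1.
have ltj : (j < size s)%N by rewrite sz_s.
have sz_u : size (take j s) = j by rewrite size_takel // ltnW.
have sz_uv : size (take j s ++ drop j.+1 s) = n.+1.
  by rewrite size_cat sz_u size_drop sz_s; lia.
rewrite nfollow_rec // natr_sum.
under eq_bigr => i _ do rewrite IHn //.
have sE : s = take j s ++ nth false s j :: drop j.+1 s by rewrite -drop_nth // cat_take_drop.
rewrite [in RHS]sE -[X in word_count _ _ X]sz_u.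
rewrite -(big_mkord (fun i => (j <= i)%N == nth false s j)
                    (fun i => word_count rat (remove s j) i)).
rewrite (@big_cat_nat _ _ _ j) //=; last by rewrite -ltnS.
case: (nth false s j).
  rewrite word_count_true ?sz_uv // big_nat_cond big1 ?add0r; last first.
    by move=> i; lia.
  rewrite -[X in \sum_(X <= _ < _ | _) _]add0n big_addn.
  have -> : (n.+1 - j)%N = size (drop j.+1 s) by rewrite size_drop sz_s subSS.
  rewrite big_mkord; apply: eq_big => [i|i _]; last by rewrite sz_u addnC.
  by rewrite leq_addl.
rewrite word_count_false ?sz_uv // addrC big_nat_cond big1 ?add0r; last first.
  by move=> i; lia.
rewrite big_nat_cond big_mkord sz_u; apply: eq_bigl => i.
by have := ltn_ord i; lia.
Qed.

(** * Alternating words and Dumont permutations *)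

Definition alt (n : nat) : seq bool := mkseq (fun i => ~~ odd i) n.

Lemma size_alt n : size (alt n) = n.
Proof. exact: size_mkseq. Qed.

Lemma altD i n : alt (i + n) = alt i ++ mkseq (fun k => ~~ odd (i + k)) n.
Proof.
by rewrite /alt /mkseq iotaD map_cat add0n -[X in iota X n]addn0 iotaDl -map_comp.
Qed.

Lemma alt_rcons m : alt m.*2.+1 = rcons (alt m.*2) true.
Proof. by rewrite /alt mkseqS odd_double. Qed.

Lemma revneg_alt m : revneg (alt m.*2) = alt m.*2.
Proof.
apply: (@eq_from_nth _ false) => [|i]; first by rewrite size_revneg.
rewrite size_revneg size_alt => lti.
have sz : size (map negb (alt m.*2)) = m.*2 by rewrite size_map size_alt.
rewrite nth_rev sz // (nth_map false) ?size_alt; last lia.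
by rewrite !nth_mkseq //; lia.
Qed.

(** The letter at index [i] belongs to the value [i.+1], hence the negation in [alt]. *)
Lemma dumont_count_word n j : (j < n.+1)%N ->
  (dumont_count n.+2 j.+1)%:R = word_count rat (alt n.+1) j.
Proof.
move=> ltj; rewrite -[j]/(nat_of_ord (Ordinal ltj)) -nfollow_word_count ?size_alt //.
congr (_%:R); apply: eq_card => p; rewrite !inE; congr (_ && _).
  apply: eq_forallb => i; apply: eq_forallb => i'.
  by rewrite nth_mkseq.
apply/existsP/eqP => [[i /andP[/eqP i0 /eqP[pij]]] | p0].
  by apply: val_inj; rewrite /= -pij; congr (nat_of_ord (p _)); apply: val_inj.
by exists ord0; rewrite p0 !eqxx.
Qed.

(** * Second differences in the first value *)

Definition even_count (m j : nat) : rat := (dumont_count m.*2.+2 j)%:R.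

Lemma even_count0 m : even_count m 0 = 0.
Proof. by rewrite /even_count dumont_count0r. Qed.

Lemma even_countkk m : even_count m m.*2.+2 = 0.
Proof. by rewrite /even_count dumont_countkk. Qed.

Lemma even_countS m j : (j < m.*2.+1)%N ->
  even_count m j.+1 = count_up rat (alt m.*2.+1) j.
Proof.
move=> ltj; rewrite /even_count dumont_count_word // /word_count.
rewrite [in revneg _]alt_rcons -cats1 revneg_cons /=.
by rewrite count_up_false_cons addr0.
Qed.

Lemma alt_cons2 n : alt n.+2 = [:: true, false & alt n].
Proof.
rewrite -add2n altD /=; do 2 congr (_ :: _).
by apply: eq_mkseq => i /=; rewrite negbK.
Qed.

Lemma even_count1 m : even_count m.+1 1 = 0.
Proof. by rewrite even_countS // doubleS alt_cons2 count_up_cons2_0. Qed.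

Lemma even_count_last m : even_count m.+1 m.*2.+3 = 0.
Proof.
rewrite -doubleS even_countS // alt_rcons.
by rewrite -[X in count_up _ _ X](size_alt m.+1.*2) count_up_rcons_size // size_alt.
Qed.

(** The right side counts all Dumont permutations of [m.*2.+1] values, whatever the first one. *)
Lemma even_count2 m : even_count m.+1 2 = (run (alt m.*2.+1) 1).[1].
Proof. by rewrite even_countS // doubleS alt_cons2 count_up_cons2_1. Qed.

(** Deleting two adjacent letters of an alternating word leaves an alternating word, so
    [count_up_diff2] relates [m.+1] to [m]. *)
Lemma even_count_diff2_inner m i : (i <= m.*2)%N ->
  even_count m.+1 i.+3 - even_count m.+1 i.+2
    - (even_count m.+1 i.+2 - even_count m.+1 i.+1)
  = - even_count m i.+1 + (-1) ^+ i.+1 * even_count m.+1 2.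
Proof.
move=> lei; rewrite even_count2 !even_countS ?doubleS; try lia.
set v := mkseq (fun k => odd (i + k)) (m.*2 - i).
have -> : alt m.*2.+3 = alt i ++ (~~ odd i) :: ~~ ~~ odd i :: ~~ odd i :: v.
  rewrite (_ : m.*2.+3 = i + (m.*2 - i).+3)%N; last lia.
  rewrite altD; congr (_ ++ _); rewrite /mkseq /= !addnS addn0 /= negbK.
  do 3 congr (_ :: _); rewrite -[3%N]/(3 + 0)%N iotaDl -map_comp.
  by apply: eq_map => k /=; rewrite !addnS /= !negbK.
have -> : alt m.*2.+1 = alt i ++ (~~ odd i) :: v.
  rewrite (_ : m.*2.+1 = i + (m.*2 - i).+1)%N; last lia.
  rewrite altD; congr (_ ++ _); rewrite /mkseq /= addn0.
  congr (_ :: _); rewrite -[1%N]/(1 + 0)%N iotaDl -map_comp.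
  by apply: eq_map => k /=; rewrite !addnS /= !negbK.
have := count_up_diff2 rat (alt i) (~~ odd i) v; rewrite /= size_alt => ->.
by rewrite negbK signr_odd exprS mulN1r mulNr.
Qed.

Lemma diff2_eq0 (x : nat -> rat) N : (0 < N)%N -> x 0%N = 0 -> x N = 0 ->
  (forall i, (i.+1 < N)%N -> x i.+2 - x i.+1 - (x i.+1 - x i) = 0) ->
  forall i, (i <= N)%N -> x i = 0.
Proof.
move=> N_gt0 x0 xN x2.
have lin i : (i < N)%N -> x i = i%:R * x 1%N /\ x i.+1 = i.+1%:R * x 1%N.
  elim: i => [|i IHi] lti; first by rewrite x0 mul0r mul1r.
  have [xi xi1] := IHi (ltnW lti); split=> //; have := x2 i lti.
  by rewrite xi xi1 -!natr1 => e; lra.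
have x1 : x 1%N = 0.
  have [|_] := lin N.-1; first by rewrite prednK.
  rewrite prednK // xN => /esym/eqP; rewrite mulf_eq0 pnatr_eq0.
  by case/orP => /eqP //; lia.
by case=> [//|i lti]; have [_ ->] := lin i lti; rewrite x1 mulr0.
Qed.

(** By induction the right side of [even_count_diff2_inner] is symmetric, as reflection preserves
    the parity of the first value. *)
Lemma even_count_sym m j : (j <= m.*2.+2)%N ->
  even_count m j = even_count m (m.*2.+2 - j).
Proof.
elim: m j => [|m IHm].
  move=> [|[|[|]]] // _; rewrite ?subn0 ?subnn ?even_count0.
    by rewrite -[2%N]/(0.*2.+2)%N even_countkk.
  by rewrite -[2%N]/(0.*2.+2)%N even_countkk.
move=> [|j] ltj; first by rewrite subn0 even_count0 even_countkk.
case: (ltnP j m.*2.+3) => [{}ltj|]; last first.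
  rewrite doubleS in ltj * => lej; have -> : j = m.*2.+3 by lia.
  by rewrite subnn -doubleS even_count0 even_countkk.
(* The boundary is placed at the first values 1 and [m.*2.+3]: the second difference at 0 and
   [m.*2.+4] is not yet available. *)
pose x i := even_count m.+1 i.+1 - even_count m.+1 (m.*2.+3 - i).
rewrite doubleS subSS; apply/eqP; rewrite -subr_eq0; apply/eqP.
apply: (@diff2_eq0 x m.*2.+2) => //.
- by rewrite /x even_count1 even_count_last subrr.
- by rewrite /x subSn // subnn even_count1 even_count_last subrr.
move=> i lti; rewrite /x.
have e1 := @even_count_diff2_inner m i ltac:(lia).
have e2 := @even_count_diff2_inner m (m.*2 - i) ltac:(lia).
have -> : (m.*2.+3 - i.+2 = (m.*2 - i).+1)%N by lia.
have -> : (m.*2.+3 - i.+1 = (m.*2 - i).+2)%N by lia.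
have -> : (m.*2.+3 - i = (m.*2 - i).+3)%N by lia.
have e3 := IHm i.+1 ltac:(lia).
rewrite (_ : m.*2.+2 - i.+1 = (m.*2 - i).+1)%N in e3; last lia.
have e4 : (-1) ^+ (m.*2 - i).+1 = (-1) ^+ i.+1 :> rat.
  by rewrite -signr_odd -[RHS]signr_odd; congr (_ ^+ _); lia.
rewrite e4 -e3 in e2; lra.
Qed.

Lemma even_count_diff2 m j : (j <= m.*2.+2)%N ->
  even_count m.+1 j.+2 - even_count m.+1 j.+1
    - (even_count m.+1 j.+1 - even_count m.+1 j)
  = - even_count m j + (-1) ^+ j * even_count m.+1 2.
Proof.
case: j => [_|i lti]; first by rewrite even_count1 !even_count0; ring.
case: (leqP i m.*2) => [|gti]; first exact: even_count_diff2_inner.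
have -> : i = m.*2.+1 by lia.
have := even_countkk m.+1; rewrite doubleS => ->.
rewrite even_count_last even_countkk.
(* At the upper end, the equation amounts to the symmetry. *)
rewrite (_ : even_count m.+1 m.*2.+2 = even_count m.+1 2); last first.
  by rewrite even_count_sym doubleS; [congr even_count; lia | lia].
by rewrite -signr_odd /= odd_double; ring.
Qed.

(* Equal to [dumont_count m.*2.+1 j] for positive [m] only: at [m = 0] this is
   [1], not [0], matching [genocchi 1 = 1]. *)
Definition odd_count (m j : nat) : rat := even_count m j + even_count m j.+1.

(** The alternating term of [even_count_diff2] cancels between consecutive first values. *)
Lemma odd_count_diff2 m j : (j <= m.*2.+1)%N ->
  odd_count m.+1 j.+2 - odd_count m.+1 j.+1
    - (odd_count m.+1 j.+1 - odd_count m.+1 j) = - odd_count m j.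
Proof.
move=> lej; rewrite /odd_count.
have e1 := @even_count_diff2 m j ltac:(lia).
have e2 := @even_count_diff2 m j.+1 ltac:(lia).
by rewrite exprS mulN1r mulNr in e2; lra.
Qed.

Lemma odd_count0 m : odd_count m.+1 0 = 0.
Proof. by rewrite /odd_count even_count0 even_count1 addr0. Qed.

Lemma odd_countkk m : odd_count m.+1 m.*2.+3 = 0.
Proof.
by rewrite /odd_count even_count_last -[m.*2.+4]/(m.+1.*2.+2) even_countkk addr0.
Qed.

(** An alternating word of even length is its own complement. Appending [true] turns both summands
    of [word_count] into values of [even_count], and symmetry makes these adjacent. *)
Lemma dumont_count_odd m j : (j <= m.*2.+3)%N ->
  (dumont_count m.*2.+3 j)%:R = odd_count m.+1 j.
Proof.
case: j => [_|j ltj]; first by rewrite dumont_count0r odd_count0.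
case: (ltnP j m.*2.+2) => [{}ltj|gtj]; last first.
  have -> : j = m.*2.+2 by lia.
  by rewrite dumont_countkk odd_countkk.
rewrite dumont_count_word // /word_count -doubleS revneg_alt size_alt /odd_count.
rewrite [even_count _ j.+2]even_count_sym ?doubleS; last lia.
rewrite (_ : m.*2.+4 - j.+2 = (m.*2.+1 - j).+1)%N; last lia.
rewrite !even_countS ?doubleS; try lia.
rewrite -doubleS alt_rcons !count_up_rcons ?size_alt ?doubleS //; lia.
Qed.

(** * Binomial sums of Genocchi numbers *)

Definition genocchi_sum (k j : nat) : rat :=
  \sum_(n < j.+1) 'C(j, n)%:R * genocchi (k - n).

Lemma genocchi_sum0 k : genocchi_sum k 0 = genocchi k.
Proof. by rewrite /genocchi_sum big_ord1 bin0 mul1r subn0. Qed.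

(** Pascal's rule. Applied twice, it gives the second difference in [j]. *)
Lemma genocchi_sumS k j :
  genocchi_sum k.+1 j.+1 = genocchi_sum k.+1 j + genocchi_sum k j.
Proof.
rewrite /genocchi_sum big_ord_recl [X in _ = X + _]big_ord_recl !bin0 -addrA.
congr (_ + _); transitivity (\sum_(i < j.+1) ('C(j, i.+1)%:R * genocchi (k - i)
                                     + 'C(j, i)%:R * genocchi (k - i))).
  by apply: eq_bigr => i _; rewrite /= /bump add1n subSS binS natrD mulrDl.
rewrite big_split /= big_ord_recr /= bin_small // mul0r addr0.
by congr (_ + _); apply: eq_bigr => i _; rewrite /= /bump add1n subSS.
Qed.

(** Coefficient comparison after multiplying the generating function by e^X + 1; the separate
    [genocchi k] comes from the 1. *)
Lemma genocchi_sum_diag k : genocchi_sum k k + genocchi k = (k == 1%N)%:R * 2.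
Proof.
have fact_neq0 n : n`!%:R != 0 :> rat by rewrite pnatr_eq0 -lt0n fact_gt0.
have := congr1 (fun x => k`!%:R * x) (genocchi_egf k).
rewrite /fps_mul mulr_sumr => egf.
transitivity (k`!%:R * fps_2X k); last first.
  by rewrite /fps_2X; case: eqP => [->|_]; rewrite ?mulr0 ?mul0r.
rewrite -egf /genocchi_sum !big_ord_recl /= !subn0 bin0.
rewrite -addrA [X in _ + X]addrC addrA; congr (_ + _).
  by rewrite /fps_expX_add1 /= fact0; field.
apply: eq_bigr => i _; rewrite /= /bump add1n.
have -> : k`!%:R = 'C(k, i.+1)%:R * (i.+1`!%:R * (k - i.+1)`!%:R) :> rat.
  by rewrite -!natrM bin_fact.
rewrite /fps_expX_add1 /= addr0.
by field; rewrite !fact_neq0.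
Qed.

(* Umbrally [genocchi_sum k j] is [G^(k-j) (G+1)^j]; this is the substitution of
   [-1-G] for [G]. *)
Lemma genocchi_sum_rev k j : (j <= k)%N ->
  genocchi_sum k j = - (-1) ^+ k * genocchi_sum k (k - j).
Proof.
have := genocchi_sum_diag; elim: k j => [|k IHk] j diag.
  rewrite leqn0 => /eqP ->; have := diag 0%N.
  by rewrite subnn genocchi_sum0 mul0r expr0 => e; lra.
pose x i := genocchi_sum k.+1 i + (-1) ^+ k.+1 * genocchi_sum k.+1 (k.+1 - i).
have xS i : (i <= k)%N -> x i.+1 = x i.
  move=> lei; rewrite /x subSS subSn // !genocchi_sumS (IHk i diag lei) exprS.
  by ring.
have x_const i : (i <= k.+1)%N -> x i = x 0%N.
  by elim: i => // i IHi lti; rewrite xS // IHi // ltnW.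
(* If [k.+1] is odd, reversal negates [x], so a constant [x] is 0; if it is even, the terms of [x 0]
   cancel by the diagonal identity. *)
suff x0 : x 0%N = 0.
  by move=> lej; have := x_const j lej; rewrite x0 /x mulNr => /eqP; rewrite addr_eq0 => /eqP.
have := x_const k.+1 (leqnn _); have := diag k.+1.
rewrite /x subnn subn0 genocchi_sum0.
case: k {IHk x xS x_const} => [|k]; rewrite /= ?mul0r ?mul1r ?expr1 => e1 e2; first lra.
by move: e2; rewrite -signr_odd; case: (odd _); rewrite ?expr0 ?expr1; lra.
Qed.

(** Reversal at [j = 0] makes the two summands of [genocchi_sum_diag] equal, and their sum is 0. *)
Lemma genocchi_odd m : genocchi m.*2.+3 = 0.
Proof.
have := genocchi_sum_diag m.*2.+3; have := @genocchi_sum_rev m.*2.+3 0 (leq0n _).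
rewrite subn0 genocchi_sum0 -signr_odd /= odd_double expr1 /= mul0r => e1 e2.
lra.
Qed.

Lemma genocchi01 : genocchi 0 = 0 /\ genocchi 1 = 1.
Proof.
have := genocchi_sum_diag 0; have := genocchi_sum_diag 1.
rewrite genocchi_sumS !genocchi_sum0 mul0r mul1r => e1 e0; split; lra.
Qed.

Lemma odd_count_genocchi m j : (j <= m.*2.+1)%N ->
  odd_count m j = (-1) ^+ m * genocchi_sum m.*2.+1 j.
Proof.
elim: m j => [|m IHm] j lej.
  have [g0 g1] := genocchi01.
  have c01 : even_count 0 1 = 1 by rewrite /even_count dumont_count21.
  have c02 := even_countkk 0.
  rewrite /odd_count; case: j lej => [|[|]] // _; rewrite ?even_count0 c01.
    by rewrite genocchi_sum0 g1; ring.
  by rewrite c02 genocchi_sumS !genocchi_sum0 g0 g1; ring.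
pose x i := odd_count m.+1 i - (-1) ^+ m.+1 * genocchi_sum m.*2.+3 i.
apply/eqP; rewrite -subr_eq0; apply/eqP.
apply: (@diff2_eq0 x m.*2.+3) => //.
- by rewrite /x odd_count0 genocchi_sum0 genocchi_odd mulr0 subrr.
- have := genocchi_sum_diag m.*2.+3; rewrite genocchi_odd /= mul0r addr0 => e.
  by rewrite /x odd_countkk e mulr0 subrr.
move=> i lti; have lei : (i <= m.*2.+1)%N by lia.
have e1 := odd_count_diff2 lei; have e2 := IHm i lei.
rewrite /x !genocchi_sumS exprS.
rewrite e2 in e1; lra.
Qed.

(** * Signs and the sums [Gsum] and [Hsum] *)

Lemma dumont_sign_odd m : dumont_sign m.*2.+1 = (-1) ^+ m.
Proof.
rewrite /dumont_sign (_ : (_ %/ 2)%Z = m) //.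
by rewrite -addn1 PoszD addrK -muln2 PoszM mulzK.
Qed.

Lemma dumont_sign_even m : dumont_sign m.*2.+2 = (-1) ^+ m.
Proof.
rewrite /dumont_sign (_ : (_ %/ 2)%Z = m) //.
by rewrite -addn1 PoszD addrK -addn1 -muln2 PoszD PoszM divzMDl // divz_small ?addr0.
Qed.

Lemma Gsum_genocchi_sum k j :
  Gsum k j = dumont_sign k * (genocchi_sum k j - genocchi k).
Proof.
rewrite /Gsum /genocchi_sum big_ord_recl /= bin0 mul1r subn0 addrAC subrr add0r.
congr (_ * _); rewrite big_add1 /= big_mkord.
by apply: eq_bigr => i _; rewrite /bump add1n.
Qed.

(** The alternating signs cancel every term except [u = j.+1]. *)
Lemma hcoefS j n : (n <= j)%N -> hcoef j.+1 n.+1 + hcoef j n.+1 = 'C(j, n)%:R.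
Proof.
move=> len; rewrite /hcoef big_nat_recr //= subnn mul1r addrAC -big_split /=.
rewrite big_nat big1 ?add0r // => u /andP[_ ltu].
by rewrite subSn // exprS; ring.
Qed.

Lemma HsumS k j : Hsum k.+1 j.+1 + Hsum k.+1 j = dumont_sign k.+1 * genocchi_sum k j.
Proof.
rewrite /Hsum -mulrDr; congr (_ * _); rewrite !big_add1 /= !big_mkord.
have hcoef_gt : hcoef j j.+1 = 0 by rewrite /hcoef big_geq.
have -> : \sum_(i < j) hcoef j i.+1 * genocchi (k.+1 - i.+1)
  = \sum_(i < j.+1) hcoef j i.+1 * genocchi (k.+1 - i.+1).
  by rewrite big_ord_recr /= hcoef_gt mul0r addr0.
rewrite -big_split /=; apply: eq_bigr => i _.
by rewrite -mulrDl hcoefS // -ltnS.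
Qed.

(** Both sides start from 0 and have the same sums of consecutive terms. *)
Lemma even_count_Hsum m j : (j <= m.*2.+2)%N -> even_count m j = Hsum m.*2.+2 j.
Proof.
elim: j => [_|j IHj ltj]; first by rewrite even_count0 /Hsum big_geq ?mulr0.
have := HsumS m.*2.+1 j; rewrite dumont_sign_even -odd_count_genocchi //.
by rewrite /odd_count IHj ?(ltnW ltj) // addrC => /addrI.
Qed.

Theorem theorem9 (k j : nat) (hjk : (j <= k)%N) :
  (dumont_count k j)%:R = (if odd k then Gsum k j else Hsum k j) :> rat.
Proof.
move: hjk; rewrite -(odd_double_half k) oddD odd_double addbF oddb.
case: (odd k); case: k./2 => [|m]; rewrite ?add1n ?add0n => lej.
(* The case [k = 1] is separate because [odd_count 0] is not the Dumont count. *)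
- rewrite Gsum_genocchi_sum; case: j lej => [|[|]] // _.
    by rewrite dumont_count0r genocchi_sum0 subrr mulr0.
  rewrite dumont_countkk genocchi_sumS !genocchi_sum0 addrAC subrr add0r.
  by have [-> _] := genocchi01; rewrite mulr0.
- rewrite Gsum_genocchi_sum dumont_sign_odd genocchi_odd subr0.
  by rewrite -odd_count_genocchi // -dumont_count_odd.
- by move: lej; rewrite leqn0 => /eqP ->; rewrite dumont_count0r /Hsum big_geq ?mulr0.
- exact: even_count_Hsum.
Qed.
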